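(* Let $y\in\mathbb{R}^n$. Let $(\hat u^{(k)})_{k\ge1}$, $(\hat b^{(k)})_{k\ge0}$ be the sequences produced by the Iterative Isotonic Regression algorithm applied to $y$, and let $(\tilde u^{(k)})_{k\ge1}$, $(\tilde b^{(k)})_{k\ge1}$ be the sequences produced by the Iterative Isotonic Bias Reduction algorithm applied to $y$. Then for all $k\ge1$, $$\hat u^{(k)}=\sum_{j=1}^k\tilde u^{(j)}\qquad\text{and}\qquad \hat b^{(k)}=\sum_{j=1}^k\tilde b^{(j)}.$$
   Context: Let $\mathcal{C}^+=\{u\in\mathbb{R}^n: u_1\le\dots\le u_n\}$ and $\mathcal{C}^-=-\mathcal{C}^+=\{b\in\mathbb{R}^n: b_1\ge\dots\ge b_n\}$. For $z\in\mathbb{R}^n$, $\mathrm{iso}(z)=\arg\min_{u\in\mathcal{C}^+}\|z-u\|^2$ and $\mathrm{anti}(z)=\arg\min_{b\in\mathcal{C}^-}\|z-b\|^2$ are the Euclidean metric projections of $z$ onto $\mathcal{C}^+$ and $\mathcal{C}^-$. Iterative Isotonic Regression (I.I.R.) applied to $y$: $\hat b^{(0)}=0$ and, for $k\ge1$, $\hat u^{(k)}=\mathrm{iso}(y-\hat b^{(k-1)})$, $\hat b^{(k)}=\mathrm{anti}(y-\hat u^{(k)})$. Iterative Isotonic Bias Reduction (I.I.B.R.) applied to $y$: $\tilde y^{(0)}=0$ and, for $k\ge1$, $\tilde u^{(k)}=\mathrm{iso}(y-\tilde y^{(k-1)})$, $\tilde b^{(k)}=\mathrm{anti}(y-\tilde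 y^{(k-1)}-\tilde u^{(k)})$, $\tilde y^{(k)}=\tilde y^{(k-1)}+\tilde u^{(k)}+\tilde b^{(k)}$. *)

(* Defs.v *)
From HB Require Import structures.
From mathcomp Require Import all_boot all_order all_algebra.
From mathcomp Require Import all_classical all_reals all_analysis.
From mathcomp Require Import ring lra.

Set Implicit Arguments.
Unset Strict Implicit.
Unset Printing Implicit Defensive.

Import Order.TTheory GRing.Theory Num.Theory.
Import numFieldNormedType.Exports.
Local Open Scope classical_set_scope.
Local Open Scope ring_scope.

(* The library norm on 'rV[R]_n is the sup norm, hence an explicit Euclidean
   one. *)
Definition sqnorm (R : realType) (n : nat) (u : 'rV[R]_n) : R :=
  \sum_(i < n) u 0 i ^+ 2.

Definition Cplus (R : realType) (n : nat) : set 'rV[R]_n :=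
  [set u | forall i j : 'I_n, (i <= j)%N -> u 0 i <= u 0 j].

Definition Cminus (R : realType) (n : nat) : set 'rV[R]_n :=
  [set b | Cplus (- b)].

Definition argmin_dist (R : realType) (n : nat) (C : set 'rV[R]_n)
    (z : 'rV[R]_n) : set 'rV[R]_n :=
  [set u | C u /\ forall v, C v -> sqnorm (z - u) <= sqnorm (z - v)].

(* The default value 0 of xget is never used for iso and anti: see isoP and
   antiP. *)
Definition metric_proj (R : realType) (n : nat) (C : set 'rV[R]_n)
    (z : 'rV[R]_n) : 'rV[R]_n := xget 0 (argmin_dist C z).

Definition iso (R : realType) (n : nat) (z : 'rV[R]_n) : 'rV[R]_n :=
  metric_proj (@Cplus R n) z.

Definition anti (R : realType) (n : nat) (z : 'rV[R]_n) : 'rV[R]_n :=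
  metric_proj (@Cminus R n) z.

Section MetricProj.
Context {R : realType} {n : nat}.
Implicit Types (C : set 'rV[R]_n) (u v z : 'rV[R]_n).

Lemma sqnorm_continuous z : continuous (fun u => sqnorm (z - u)).
Proof.
apply: continuous_big => [|i _ u].
  exact: add_continuous.
have c : {for u, continuous (fun v : 'rV[R]_n => z 0 i - v 0 i)}.
  apply: (@continuousB _ R^o _ (fun=> z 0 i)); first exact: cst_continuous.
  exact: coord_continuous.
rewrite (_ : (fun v => _) = (fun v => (z 0 i - v 0 i) * (z 0 i - v 0 i))).
  exact: (continuousM c c).
by apply/funext => v; rewrite !mxE expr2.
Qed.

Lemma argmin_dist_neq0 C z : closed C -> C !=set0 -> argmin_dist C z !=set0.
Proof.
move=> clC [c Cc].
pose B := [set u | sqnorm (z - u) <= sqnorm (z - c)].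
have cptA : compact (C `&` B).
  apply: bounded_closed_compact; last first.
    apply: closedI => //.
    rewrite (_ : B = (fun u => sqnorm (z - u)) @^-1` [set x | x <= sqnorm (z - c)])//.
    by apply: preimage_closed => [x _|]; [exact: sqnorm_continuous|exact: closed_le].
  exists (`|z| + (sqnorm (z - c) + 1)); split; first exact: num_real.
  move=> M ltM u [_ Bu]; apply: le_trans (ltW ltM).
  rewrite -{1}(subKr z u); apply: le_trans (ler_normB _ _) _; rewrite lerD2l.
  have s0 : 0 <= sqnorm (z - c) by apply: sumr_ge0 => i _; exact: sqr_ge0.
  rewrite [leLHS]mx_normrE; apply/bigmax_leP; split; first by rewrite addr_ge0.
  move=> [i j] _ /=; rewrite (ord1 i).
  have : ((z - u) 0 j) ^+ 2 <= sqnorm (z - c).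
    apply: le_trans Bu; rewrite /sqnorm (bigD1 j)//= lerDl.
    by apply: sumr_ge0 => k _; exact: sqr_ge0.
  rewrite -real_normK ?num_real//; set t := `|_| => Ht.
  by have := sqr_ge0 (t - 1); nra.
have A0 : C `&` B !=set0 by exists c; split => //; rewrite /B /=.
have [|u /set_mem[Cu Bu] umin] := EVT_min_rV (f := fun u => sqnorm (z - u)) A0 cptA.
  by apply: continuous_subspaceT; exact: sqnorm_continuous.
exists u; split => // v Cv.
have [Bv|/ltW] := leP (sqnorm (z - v)) (sqnorm (z - c)); first by apply: umin; exact/mem_set.
exact: le_trans.
Qed.

Lemma metric_projP C z : closed C -> C !=set0 ->
  argmin_dist C z (metric_proj C z).
Proof.
by move=> clC C0; apply: xgetPex; exact: argmin_dist_neq0.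
Qed.

Lemma argmin_dist_uniq C z u v :
  (forall x y, C x -> C y -> C (2^-1 *: (x + y))) ->
  argmin_dist C z u -> argmin_dist C z v -> u = v.
Proof.
move=> midC [Cu um] [Cv vm].
have uv : sqnorm (z - u) = sqnorm (z - v).
  by apply/eqP; rewrite eq_le um// vm.
have := um _ (midC _ _ Cu Cv).
have -> : sqnorm (z - 2^-1 *: (u + v)) =
    2^-1 * (sqnorm (z - u) + sqnorm (z - v)) - 4^-1 * sqnorm (u - v).
  rewrite /sqnorm -big_split/= !mulr_sumr -sumrB.
  by apply: eq_bigr => i _; rewrite !mxE; field.
rewrite -uv => le0.
have {le0} /eqP : sqnorm (u - v) = 0.
  apply/eqP; rewrite eq_le; apply/andP; split; first by lra.
  by apply: sumr_ge0 => i _; exact: sqr_ge0.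
rewrite psumr_eq0 => [/allP d0|i _]; last exact: sqr_ge0.
apply/rowP => i; apply/eqP; rewrite -subr_eq0 -sqrf_eq0.
by have := d0 i (mem_index_enum _); rewrite !mxE.
Qed.

Lemma closed_Cplus : closed (@Cplus R n).
Proof.
rewrite (_ : @Cplus R n = \bigcap_(p in [set p : 'I_n * 'I_n | (p.1 <= p.2)%N])
    ((fun u : 'rV[R]_n => u 0 p.2 - u 0 p.1) @^-1` [set x | 0 <= x])).
  apply: closed_bigI => p _; apply: preimage_closed => [u _|]; last exact: closed_ge.
  by apply: (@continuousB _ R^o); exact: coord_continuous.
apply/seteqP; split => [u Cu p /= /Cu|u Cu i j ij]; first by rewrite subr_ge0.
by have := Cu (i, j) ij; rewrite /= subr_ge0.
Qed.

Lemma closed_Cminus : closed (@Cminus R n).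
Proof.
apply: preimage_closed => [u _|]; last exact: closed_Cplus.
exact: opp_continuous.
Qed.

Lemma Cplus_mid u v : Cplus u -> Cplus v -> Cplus (2^-1 *: (u + v)).
Proof.
move=> Cu Cv i j ij; rewrite !mxE.
by have := Cu _ _ ij; have := Cv _ _ ij; lra.
Qed.

Lemma Cminus_mid u v : Cminus u -> Cminus v -> Cminus (2^-1 *: (u + v)).
Proof.
by move=> Cu Cv; rewrite /Cminus/= -scalerN opprD; exact: Cplus_mid.
Qed.

Lemma isoP z u : argmin_dist (@Cplus R n) z u <-> u = iso z.
Proof.
have zP : argmin_dist (@Cplus R n) z (iso z).
  apply: metric_projP; first exact: closed_Cplus.
  by exists 0 => i j _; rewrite !mxE.
by split=> [uP|->//]; apply: argmin_dist_uniq uP zP; exact: Cplus_mid.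
Qed.

Lemma antiP z b : argmin_dist (@Cminus R n) z b <-> b = anti z.
Proof.
have zP : argmin_dist (@Cminus R n) z (anti z).
  apply: metric_projP; first exact: closed_Cminus.
  by exists 0 => i j _; rewrite !mxE.
by split=> [bP|->//]; apply: argmin_dist_uniq bP zP; exact: Cminus_mid.
Qed.

End MetricProj.

(* In both predicates below the values u 0 (and b 0 in IIBR) are
   unconstrained: those sequences start at index 1. *)
Definition IIR (R : realType) (n : nat) (y : 'rV[R]_n)
    (u b : nat -> 'rV[R]_n) : Prop :=
  b 0%N = 0 /\
  forall k, (1 <= k)%N ->
    u k = iso (y - b (k - 1)%N) /\ b k = anti (y - u k).

Definition IIBR (R : realType) (n : nat) (y : 'rV[R]_n)
    (u b yt : nat -> 'rV[R]_n) : Prop :=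
  yt 0%N = 0 /\
  forall k, (1 <= k)%N ->
    [/\ u k = iso (y - yt (k - 1)%N),
        b k = anti (y - yt (k - 1)%N - u k) &
        yt k = yt (k - 1)%N + u k + b k].

(* Main.v *)
Require Import Defs.
From mathcomp Require Import all_boot all_order all_algebra.
From mathcomp Require Import all_classical all_reals all_analysis.
From mathcomp Require Import ring lra.

Set Implicit Arguments.
Unset Strict Implicit.
Unset Printing Implicit Defensive.

Import Order.TTheory GRing.Theory Num.Theory.
Local Open Scope ring_scope.

(** The two algorithms agree as soon as, at each step,
      [iso (u + r) = u + iso r],
    where [u] is the current isotonic part and [r] the current residual, and
    symmetrically for [anti].  Projections onto a cone are not additive, so
    this uses how [r] arises: [u = iso (u + r')] for the previous residual
    [r'], and [r = r' - anti r'].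

    By the characterisation of projections onto a cone ([isoE]), [u + iso r]
    is the projection of [u + r] as soon as the residual [r - iso r], which
    lies in the polar cone of the isotonic cone, is orthogonal to [u].  Put
    [c = - anti r'], an isotonic vector, so that [r = c + r'].  As [r'] is
    orthogonal to [u],
      [<r - iso r, u> = - <iso (c + r') - c, u>],
    and the left-hand side is nonpositive.  It remains to see that
    [iso (c + r') - c] is in the polar cone: moving [c] by an element of the
    polar cone and projecting back moves it by an element of the polar cone
    ([iso_shift_polar]).  In terms of cumulative sums, [iso] takes the greatest
    convex minorant, elements of the polar cone have nonnegative cumulative
    sums with total zero, and the claim says that a convex minorant of a
    function lies below its greatest convex minorant.  The proof below
    replaces minorants by a discrete maximum principle on tail sums. *)

(** * The scalar product and projections onto convex cones *)

Definition dot (R : realType) (n : nat) (x v : 'rV[R]_n) : R :=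
  \sum_(i < n) x 0 i * v 0 i.

Section Dot.
Context {R : realType} {n : nat}.
Implicit Types (x v z u d : 'rV[R]_n) (C : set 'rV[R]_n).

Lemma dotDl x1 x2 v : dot (x1 + x2) v = dot x1 v + dot x2 v.
Proof. by rewrite -big_split; apply: eq_bigr => i _; rewrite !mxE mulrDl. Qed.

Lemma dotNl x v : dot (- x) v = - dot x v.
Proof. by rewrite -sumrN; apply: eq_bigr => i _; rewrite !mxE mulNr. Qed.

Lemma dotDr x v1 v2 : dot x (v1 + v2) = dot x v1 + dot x v2.
Proof. by rewrite -big_split; apply: eq_bigr => i _; rewrite !mxE mulrDr. Qed.

Lemma dotNr x v : dot x (- v) = - dot x v.
Proof. by rewrite -sumrN; apply: eq_bigr => i _; rewrite !mxE mulrN. Qed.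

Lemma sqnorm_ge0 x : 0 <= sqnorm x.
Proof. by apply: sumr_ge0 => i _; exact: sqr_ge0. Qed.

Lemma sqnormBZ x d (t : R) :
  sqnorm (x - t *: d) = sqnorm x - 2 * t * dot x d + t ^+ 2 * sqnorm d.
Proof.
rewrite /sqnorm /dot !mulr_sumr -sumrB -big_split/=.
by apply: eq_bigr => i _; rewrite !mxE; ring.
Qed.

Lemma argmin_dist_first_order C z u d : argmin_dist C z u ->
  (forall t : R, 0 <= t <= 1 -> C (u + t *: d)) -> dot (z - u) d <= 0.
Proof.
move=> [_ umin] Cud; rewrite leNgt; apply/negP => a_gt0.
have s_ge0 := sqnorm_ge0 d.
move: a_gt0 (Cud); set a := dot _ _; set s := sqnorm d in s_ge0 * => a_gt0 _.
(* This step is at most 1 and makes the linear gain exceed the quadratic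
   loss, since [t * s < a]. *)
pose t := a / (a + s + 1).
have den_gt0 : 0 < a + s + 1 by lra.
have t_gt0 : 0 < t by rewrite divr_gt0.
have t_le1 : t <= 1 by rewrite ler_pdivrMr//; lra.
have ts : t * (a + s + 1) = a by rewrite divfK// gt_eqF.
have := umin _ (Cud t _); rewrite (ltW t_gt0) t_le1 => /(_ isT).
rewrite opprD addrA sqnormBZ -/a -/s => le_s.
have : t * (2 * a - t * s) <= 0 by lra.
by rewrite pmulr_rle0//; have := mulr_gt0 t_gt0 a_gt0; lra.
Qed.

(** Moreau's characterisation of the projection onto a convex cone: the
    residual is in the polar cone and orthogonal to the projection. *)
Lemma argmin_dist_coneP C z u :
  (forall v w, C v -> C w -> C (v + w)) ->
  (forall (t : R) v, 0 <= t -> C v -> C (t *: v)) ->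
  argmin_dist C z u <->
  [/\ C u, forall v, C v -> dot (z - u) v <= 0 & dot (z - u) u = 0].
Proof.
move=> CD CZ; split=> [umin|[Cu polu orthu]].
  have Cu : C u by case: umin.
  have polu v : C v -> dot (z - u) v <= 0.
    move=> Cv; apply: argmin_dist_first_order umin _ => t /andP[t0 _].
    by apply: CD => //; exact: CZ.
  split=> //; apply/eqP; rewrite eq_le polu//= -oppr_le0 -dotNr.
  apply: argmin_dist_first_order umin _ => t /andP[_ t1].
  by rewrite scalerN -[u in u - _]scale1r -scalerBl; apply: CZ; rewrite ?subr_ge0.
split=> // v Cv.
have -> : z - v = (z - u) - 1 *: (v - u).
  by rewrite scale1r opprB addrA subrK.
rewrite sqnormBZ dotDr dotNr orthu.
by have := polu v Cv; have := sqnorm_ge0 (v - u); lra.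
Qed.

End Dot.

(** * Isotonic and antitonic projections *)

Definition polar_Cplus (R : realType) (n : nat) (x : 'rV[R]_n) : Prop :=
  forall v, Cplus v -> dot x v <= 0.

Section IsoAnti.
Context {R : realType} {n : nat}.
Implicit Types (z u v : 'rV[R]_n).

Lemma CplusD u v : Cplus u -> Cplus v -> Cplus (u + v).
Proof. by move=> Cu Cv i j ij; rewrite !mxE lerD ?Cu ?Cv. Qed.

Lemma CplusZ (t : R) v : 0 <= t -> Cplus v -> Cplus (t *: v).
Proof. by move=> t0 Cv i j ij; rewrite !mxE ler_wpM2l ?Cv. Qed.

Lemma isoE z u :
  u = iso z <-> [/\ Cplus u, polar_Cplus (z - u) & dot (z - u) u = 0].
Proof.
rewrite -isoP; apply: argmin_dist_coneP; [exact: CplusD|exact: CplusZ].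
Qed.

Lemma antiE z : anti z = - iso (- z).
Proof.
have [Ciso isomin] := (isoP (- z) _).2 erefl.
have sqnormN v : sqnorm (- v) = sqnorm v.
  by apply: eq_bigr => i _; rewrite mxE sqrrN.
apply/esym/antiP; split; first by rewrite /Cminus/= opprK.
move=> v Cv; rewrite -sqnormN -[leRHS]sqnormN !opprD.
by rewrite opprK; exact: isomin.
Qed.

End IsoAnti.

(** * Tail sums and the polar of the isotonic cone *)

Definition tail_sum (R : realType) (n : nat) (x : 'rV[R]_n) (p : nat) : R :=
  \sum_(i < n | (p <= i)%N) x 0 i.

Section TailSum.
Context {R : realType} {m : nat}.
Implicit Types (x v q c : 'rV[R]_m.+1).

Lemma tail_sumB x v p : tail_sum (x - v) p = tail_sum x p - tail_sum v p.
Proof. by rewrite -sumrB; apply: eq_bigr => i _; rewrite !mxE. Qed.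

Lemma tail_sum_default x p : (m < p)%N -> tail_sum x p = 0.
Proof.
move=> mp; rewrite /tail_sum big_pred0// => i; apply/negbTE.
by rewrite -ltnNge (leq_trans (ltn_ord i)).
Qed.

Lemma tail_sumS x p : (p <= m)%N ->
  tail_sum x p = x 0 (inord p) + tail_sum x p.+1.
Proof.
move=> pm; rewrite /tail_sum (bigD1 (inord p)) /= ?inordK//; congr (_ + _).
by apply: eq_bigl => i; rewrite -val_eqE/= inordK// ltn_neqAle andbC eq_sym.
Qed.

Lemma dot_step x p : dot x (\row_i ((p <= i)%N%:R)) = tail_sum x p.
Proof.
rewrite /tail_sum big_mkcond; apply: eq_bigr => i _.
by rewrite mxE; case: leqP; rewrite ?mulr1 ?mulr0.
Qed.

Lemma Cplus_inordS v p : Cplus v -> (p < m)%N ->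
  v 0 (inord p) <= v 0 (inord p.+1).
Proof. by move=> Cv pm; apply: Cv; rewrite !inordK// ltnS ltnW. Qed.

(** Abel summation, with the increments of [v] as weights: they are
    nonnegative when [v] is isotonic. *)
Lemma dot_tail_sum x v : dot x v = v 0 ord0 * tail_sum x 0 +
  \sum_(0 <= p < m) (v 0 (inord p.+1) - v 0 (inord p)) * tail_sum x p.+1.
Proof.
have -> : dot x v = \sum_(i < m.+1) (x 0 i * v 0 ord0 +
    \sum_(0 <= p < m | (p < i)%N)
       x 0 i * (v 0 (inord p.+1) - v 0 (inord p))).
  apply: eq_bigr => i _; rewrite -mulr_sumr -mulrDr; congr (_ * _).
  have im : (i <= m)%N by rewrite -ltnS.
  rewrite -(big_nat_widen 0 i m predT)//.
  rewrite (telescope_sumr (fun p => v 0 (inord p)))// inord_val.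
  have -> : inord 0 = ord0 :> 'I_m.+1 by apply/val_inj; rewrite /= inordK.
  by rewrite addrC subrK.
rewrite big_split/= -mulr_suml mulrC; congr (_ * _ + _).
under eq_bigr do rewrite big_mkcond/=.
rewrite exchange_big/=; apply: eq_bigr => p _.
rewrite -big_mkcond/= mulr_sumr; apply: eq_bigr => i _; exact: mulrC.
Qed.

(** The polar of the isotonic cone in coordinates: it suffices to test against
    the extreme rays, which are the step vectors and the two signs of the
    constant vector. *)
Lemma polar_CplusP x :
  polar_Cplus x <-> tail_sum x 0 = 0 /\ forall p, tail_sum x p <= 0.
Proof.
split=> [polx|[x0 xle0] v Cv].
  have le0 p : tail_sum x p <= 0.
    rewrite -dot_step; apply: polx => i j ij; rewrite !mxE ler_nat.
    by case: (leqP p i) => //= pi; rewrite (leq_trans pi ij).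
  split=> //; apply/eqP; rewrite eq_le le0 -oppr_le0 -dot_step -dotNr.
  by apply: polx => i j _; rewrite !mxE.
rewrite dot_tail_sum x0 mulr0 add0r big_nat_cond; apply: sumr_le0 => p.
rewrite andbT => /andP[_ pm]; rewrite mulr_ge0_le0// subr_ge0.
exact: Cplus_inordS.
Qed.

(** Complementary slackness: by Abel summation, [dot x v] is a sum of
    nonpositive terms. *)
Lemma polar_ortho_flat x v p : Cplus v -> polar_Cplus x -> dot x v = 0 ->
  (p < m)%N -> tail_sum x p.+1 < 0 -> v 0 (inord p.+1) = v 0 (inord p).
Proof.
move=> Cv /polar_CplusP[x0 xle0] /eqP; rewrite dot_tail_sum x0 mulr0 add0r.
rewrite -oppr_eq0 -sumrN big_mkord psumr_eq0 => [/allP terms0 pm xp|[q qm] _/=].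
  have := terms0 (Ordinal pm) (mem_index_enum _).
  by rewrite /= oppr_eq0 mulf_eq0 (lt_eqF xp) orbF subr_eq0 => /eqP.
by rewrite oppr_ge0 mulr_ge0_le0// subr_ge0; exact: Cplus_inordS.
Qed.

End TailSum.

(** * Compatibility of the projection with the polar order *)

Section Shift.
Context {R : realType}.

(** A discrete maximum principle for the tail sums [D] of [iso (c + r) - c].
    Where [D] is positive, the residual has a negative tail sum, hence
    [iso (c + r)] is locally constant and [D] is convex there.  So once
    positive, [D] keeps increasing, which contradicts its vanishing at the
    end. *)
Lemma iso_shift_polar n (c r : 'rV[R]_n) :
  Cplus c -> polar_Cplus r -> polar_Cplus (iso (c + r) - c).
Proof.
case: n c r => [|m] c r Cc polr; first by move=> v _; rewrite /dot big_ord0.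
have [] := (isoE (c + r) _).1 erefl; set q := iso _ => Cq pole orthe.
have [r0 rle0] := (polar_CplusP _).1 polr.
have [e0 ele0] := (polar_CplusP _).1 pole.
pose D := tail_sum (q - c).
have DE p : D p = tail_sum r p - tail_sum (c + r - q) p.
  by rewrite -tail_sumB; congr tail_sum; apply/rowP => i; rewrite !mxE; ring.
have D0 : D 0%N = 0 by rewrite DE r0 e0 subrr.
have neg_entry p : (p <= m)%N -> 0 < D p -> (q - c) 0 (inord p) < 0.
  elim: p => [|p IHp] pm Dp; first by rewrite D0 ltxx in Dp.
  have neg_prev : (q - c) 0 (inord p) < 0.
    have [Dp0|] := leP (D p) 0; last exact: IHp (ltnW pm).
    by move: Dp; have := tail_sumS (q - c) (ltnW pm); rewrite -!/(D _); lra.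
  have flat : q 0 (inord p.+1) = q 0 (inord p).
    apply: polar_ortho_flat Cq pole orthe pm _.
    by have := DE p.+1; have := rle0 p.+1; lra.
  by move: neg_prev (Cplus_inordS Cc pm); rewrite !mxE flat; lra.
have grow p : 0 < D p -> 0 < D p.+1.
  have [pm|mp] := leqP p m; last by rewrite /D tail_sum_default// ltxx.
  move=> Dp; have := neg_entry p pm Dp; have := tail_sumS (q - c) pm; move: Dp.
  by rewrite -!/(D _); lra.
apply/polar_CplusP; split=> // p; rewrite leNgt; apply/negP => Dp.
have : 0 < D (m.+1 + p)%N.
  by elim: m.+1 => [//|k IHk]; rewrite addSn; exact: grow.
by rewrite /D tail_sum_default ?ltxx// addSn ltnS leq_addr.
Qed.

End Shift.

(** * Additivity along the iterations *)

Section Iteration.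
Context {R : realType} {n : nat}.
Implicit Types u b r : 'rV[R]_n.

(** Among the conditions of [isoE] for [u + iso (r - anti r)], only the
    orthogonality of the final residual to [u] is not inherited from
    [iso (r - anti r)]; one inequality is polarity, the other one is
    [iso_shift_polar]. *)
Lemma iso_additive u r : u = iso (u + r) ->
  iso (u + (r - anti r)) = u + iso (r - anti r).
Proof.
move=> /isoE[Cu]; rewrite [u + r]addrC addrK => polr orthr.
rewrite antiE opprK; set c := iso (- r).
have [Cc _ _] := (isoE (- r) _).1 erefl; rewrite -/c in Cc.
have := iso_shift_polar Cc polr; rewrite [c + r]addrC.
have [] := (isoE (r + c) _).1 erefl; set q := iso (r + c) => Cq pole orthe polqc.
apply/esym/isoE.
have -> : u + (r + c) - (u + q) = r + c - q by rewrite opprD addrACA subrr add0r.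
split=> //; first exact: CplusD.
rewrite dotDr orthe addr0; apply/eqP; rewrite eq_le pole//=.
have -> : r + c - q = r - (q - c) by rewrite opprB addrA.
by rewrite dotDl dotNl orthr add0r oppr_ge0 polqc.
Qed.

Lemma anti_additive b r : b = anti (b + r) ->
  anti (b + (r - iso r)) = b + anti (r - iso r).
Proof.
rewrite antiE opprD => bE.
have antiNr : anti (- r) = - iso r by rewrite antiE opprK.
have := @iso_additive (- b) (- r); rewrite antiNr -opprD => /(_ _)/wrap[].
  by rewrite {1}bE opprK opprD.
by rewrite !antiE !opprD => ->; rewrite opprD !opprK.
Qed.

End Iteration.

Theorem theorem2 (R : realType) (n : nat) (y : 'rV[R]_n)
    (uhat bhat : nat -> 'rV[R]_n) (util btil ytil : nat -> 'rV[R]_n)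
    (hIIR : IIR y uhat bhat) (hIIBR : IIBR y util btil ytil) :
  forall k : nat, (1 <= k)%N ->
    uhat k = \sum_(1 <= j < k.+1) util j /\
    bhat k = \sum_(1 <= j < k.+1) btil j.
Proof.
have [b0 IIR_S] := hIIR; have [y0 IIBR_S] := hIIBR.
pose U k := \sum_(1 <= j < k.+1) util j.
pose B k := \sum_(1 <= j < k.+1) btil j.
have U0 : U 0%N = 0 by rewrite /U big_nil.
have B0 : B 0%N = 0 by rewrite /B big_nil.
have US k : U k.+1 = U k + util k.+1 by rewrite /U big_nat_recr.
have BS k : B k.+1 = B k + btil k.+1 by rewrite /B big_nat_recr.
have uhatS k : uhat k.+1 = iso (y - bhat k).
  by have [-> _] := IIR_S k.+1 isT; rewrite subn1.
have bhatS k : bhat k.+1 = anti (y - uhat k.+1) by case: (IIR_S k.+1 isT).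
have ytilE k : ytil k = U k + B k.
  elim: k => [|k IHk]; first by rewrite y0 U0 B0 addr0.
  have [_ _ ->] := IIBR_S k.+1 isT.
  by rewrite subn1/= IHk US BS -addrA addrACA.
have utilS k : util k.+1 = iso (y - U k - B k).
  by have [-> _ _] := IIBR_S k.+1 isT; rewrite subn1/= ytilE opprD addrA.
have btilS k : btil k.+1 = anti (y - U k.+1 - B k).
  have [_ -> _] := IIBR_S k.+1 isT; rewrite subn1/= ytilE US !opprD !addrA.
  by congr anti; rewrite [LHS]addrAC.
(* The residual after a half-step is the previous residual minus its
   projection, as [iso_additive] and [anti_additive] require. *)
have resU k : y - U k.+1 - B k = (y - U k - B k) - iso (y - U k - B k).
  by rewrite -utilS US opprD addrA [LHS]addrAC.
have resB k : y - U k.+1 - B k.+1 =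
    (y - U k.+1 - B k) - anti (y - U k.+1 - B k).
  by rewrite -btilS BS opprD addrA.
(* Both outputs of step [k.+1] matter at step [k.+2], but [uhat k.+1] was
   computed from [bhat k], hence the middle conjunct. *)
suff invariant k : [/\ uhat k.+1 = U k.+1, bhat k = B k & bhat k.+1 = B k.+1].
  by case=> // k _; have [-> _ ->] := invariant k.
elim: k => [|k [uhatE bhatE bhatE1]].
  have uhat1 : uhat 1%N = U 1%N.
    by rewrite uhatS b0 US utilS U0 B0 !subr0 add0r.
  by split; rewrite ?b0 ?B0// bhatS uhat1 BS btilS B0 subr0 add0r.
have uhatE1 : uhat k.+2 = U k.+2.
  rewrite uhatS bhatE1 US utilS resB -iso_additive.
    by congr iso; rewrite -resB addrAC [RHS]addrC subrK.
  by rewrite -uhatE uhatS bhatE; congr iso; rewrite addrAC [RHS]addrC subrK.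
split=> //; rewrite bhatS uhatE1 BS btilS resU -anti_additive.
  by congr anti; rewrite -resU [RHS]addrC subrK.
by rewrite -bhatE1 bhatS uhatE; congr anti; rewrite [RHS]addrC subrK.
Qed.
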